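(* Let $p\ge 2$ be an integer. For $n,k\ge 0$ let $a_{n,k}$ be the number of elements of $\mathbb{F}_n^p$ having exactly $k$ upper covers in $\mathbb{F}_n^p$. Then $$\sum_{n\ge 0}\sum_{k\ge 0} a_{n,k}\,x^ny^k=\frac{(1-x)\bigl(1+(y-1)x^p\bigr)}{1-2x+x^{p+1}-(y-1)\bigl(x^2-x^p+x^{p+1}-x^{p+2}\bigr)}.$$
   Context: A Dyck path of semilength $n\ge 0$ is a lattice path from $(0,0)$ to $(2n,0)$ with steps $U=(1,1)$ and $D=(1,-1)$ that never goes below the $x$-axis; it is identified with its word over $\{U,D\}$ (the empty path is the unique one of semilength $0$). A path avoids a pattern $\alpha$ (a word over $\{U,D\}$) if $\alpha$ does not occur as a factor, i.e. as a block of consecutive steps. For an integer $p\ge 2$, $\mathcal{F}_n^p$ denotes the set of Dyck paths of semilength $n$ avoiding both $DUU$ and $D^{p+1}$. It is partially ordered by the Stanley order: $P\le Q$ iff the path $P$ lies weakly below the path $Q$ when both are drawn in the plane. $\mathbb{F}_n^p$ denotes the poset $(\mathcal{F}_n^p,\le)$. An upper cover of $P$ is an element $Q$ with $P<Q$ and no element strictly between them in $\mathbb{F}_n^p$. *)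

(* Defs.v *)
From HB Require Import structures.
From mathcomp Require Import all_boot all_order all_algebra.
From mathcomp Require Import boolp zify.

Set Implicit Arguments.
Unset Strict Implicit.
Unset Printing Implicit Defensive.

Import Order.TTheory GRing.Theory Num.Theory.
Local Open Scope ring_scope.

Record fps (R : Type) := Fps { coefs :> nat -> R }.

HB.instance Definition _ (R : Type) := gen_eqMixin (fps R).
HB.instance Definition _ (R : Type) := gen_choiceMixin (fps R).

Lemma fpsP (R : Type) (f g : fps R) : f =1 g -> f = g.
Proof. by case: f g => [f] [g] /= /funext ->. Qed.

Definition fps_const (R : nzRingType) (c : R) : fps R :=
  Fps (fun n => if n == 0%N then c else 0).

Definition fps_var (R : nzRingType) : fps R := Fps (fun n => (n == 1%N)%:R).

Section Zmodule.
Context (R : zmodType).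

Definition fps_zero : fps R := Fps (fun=> 0).
Definition fps_opp (f : fps R) : fps R := Fps (fun n => - f n).
Definition fps_add (f g : fps R) : fps R := Fps (fun n => f n + g n).

Fact fps_addA : associative fps_add.
Proof. by move=> f g h; apply: fpsP => n /=; rewrite addrA. Qed.
Fact fps_addC : commutative fps_add.
Proof. by move=> f g; apply: fpsP => n /=; rewrite addrC. Qed.
Fact fps_add0 : left_id fps_zero fps_add.
Proof. by move=> f; apply: fpsP => n /=; rewrite add0r. Qed.
Fact fps_addN : left_inverse fps_zero fps_opp fps_add.
Proof. by move=> f; apply: fpsP => n /=; rewrite addNr. Qed.

HB.instance Definition _ :=
  GRing.isZmodule.Build (fps R) fps_addA fps_addC fps_add0 fps_addN.

Lemma coef_fps0 n : (0 : fps R) n = 0. Proof. by []. Qed.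
Lemma coef_fpsN (f : fps R) n : (- f) n = - f n. Proof. by []. Qed.
Lemma coef_fpsD (f g : fps R) n : (f + g) n = f n + g n. Proof. by []. Qed.
Lemma coef_fps_sum I (r : seq I) (P : pred I) (F : I -> fps R) n :
  (\sum_(i <- r | P i) F i) n = \sum_(i <- r | P i) F i n.
Proof. exact: (big_morph (fun f : fps R => f n)). Qed.

End Zmodule.

Section Ring.
Context (R : comNzRingType).

Definition fps_mul (f g : fps R) : fps R :=
  Fps (fun n => \sum_(i < n.+1) f i * g (n - i)%N).

Let trunc n (f : fps R) : {poly R} := \poly_(i < n.+1) f i.

Let coef_trunc n (f : fps R) i : (i <= n)%N -> (trunc n f)`_i = f i.
Proof. by move=> lein; rewrite coef_poly ltnS lein. Qed.

Let coef_truncM n (f g : fps R) i :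
  (i <= n)%N -> fps_mul f g i = (trunc n f * trunc n g)`_i.
Proof.
move=> lein; rewrite coefM; apply: eq_bigr => j _.
have leji : (j <= i)%N by rewrite -ltnS.
by rewrite !coef_trunc // ?(leq_trans leji) // (leq_trans (leq_subr _ _)).
Qed.

Fact fps_mulA : associative fps_mul.
Proof.
move=> f g h; apply: fpsP => n.
transitivity ((trunc n f * (trunc n g * trunc n h))`_n).
  rewrite coefM; apply: eq_bigr => i _.
  by rewrite coef_trunc ?leq_ord // (coef_truncM _ _ (leq_subr i n)).
rewrite mulrA coefM; apply: eq_bigr => i _.
by rewrite coef_trunc ?leq_subr // -coef_truncM // leq_ord.
Qed.

Fact fps_mulC : commutative fps_mul.
Proof.
by move=> f g; apply: fpsP => n; rewrite !(coef_truncM _ _ (leqnn n)) mulrC.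
Qed.

Fact fps_mul1 : left_id (fps_const 1) fps_mul.
Proof.
move=> f; apply: fpsP => n /=.
rewrite big_ord_recl /= mul1r subn0 big1 ?addr0 // => i _.
by rewrite mul0r.
Qed.

Fact fps_mulD : left_distributive fps_mul +%R.
Proof.
move=> f g h; apply: fpsP => n /=; rewrite -big_split /=.
by apply: eq_bigr => i _; rewrite mulrDl.
Qed.

Fact fps_one_neq0 : fps_const (1 : R) != 0.
Proof.
apply/eqP => /(congr1 (fun f : fps R => f 0%N)) /= /eqP.
by rewrite oner_eq0.
Qed.

HB.instance Definition _ := GRing.Zmodule_isComNzRing.Build (fps R)
  fps_mulA fps_mulC fps_mul1 fps_mulD fps_one_neq0.

Lemma coef_fps1 n : (1 : fps R) n = (n == 0%N)%:R.
Proof. by rewrite [1]/(fps_const 1) /=; case: eqP. Qed.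
Lemma coef_fpsM (f g : fps R) n :
  (f * g) n = \sum_(i < n.+1) f i * g (n - i)%N.
Proof. by []. Qed.

End Ring.

Section UnitRing.
Context (R : comUnitRingType).
Implicit Types f g h : fps R.

Definition fps_unit : pred (fps R) := fun f => f 0%N \is a GRing.unit.

(* Writing f = c (1 - h) with h without constant term, the inverse of f is
   c^-1 (1 + h + h^2 + ...); only the powers up to n reach degree n. *)
Definition fps_inv f : fps R :=
  if fps_unit f then
    let c := fps_const (f 0%N)^-1 in
    let h := 1 - c * f in
    c * Fps (fun n => (\sum_(i < n.+1) h ^+ i) n)
  else f.

Let coef_exp_eq0 h i n : h 0%N = 0 -> (n < i)%N -> (h ^+ i) n = 0.
Proof.
move=> h0; elim: i n => // i IHi n ltni.
rewrite exprS coef_fpsM big1 // => -[[|j] ltj] _ /=; first by rewrite h0 mul0r.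
rewrite IHi ?mulr0 //.
by case: n ltni ltj => // n; rewrite !ltnS subSS => /(leq_ltn_trans (leq_subr j n)).
Qed.

Fact fps_mulV : {in fps_unit, left_inverse 1 fps_inv *%R}.
Proof.
move=> f Uf; rewrite /fps_inv; have -> : fps_unit f by [].
set c := fps_const _; set h := 1 - c * f; set g := Fps _.
have h0 : h 0%N = 0.
  rewrite coef_fpsD coef_fpsN coef_fps1 coef_fpsM big_ord1 /= mulVr //.
  exact: subrr.
have -> : c * g * f = (1 - h) * g.
  by rewrite /h opprB addrC subrK mulrAC.
apply: fpsP => n.
have -> : ((1 - h) * g) n = ((1 - h) * \sum_(i < n.+1) h ^+ i) n.
  rewrite !coef_fpsM; apply: eq_bigr => i _; congr (_ * _) => /=.
  have le_m : ((n - i).+1 <= n.+1)%N by rewrite ltnS leq_subr.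
  rewrite !coef_fps_sum (big_ord_widen _ (fun j => (h ^+ j) (n - i)%N) le_m).
  rewrite big_mkcond; apply: eq_bigr => j _; case: ifPn => //.
  by rewrite -leqNgt => ltj; rewrite coef_exp_eq0.
rewrite -[_ * _]opprK -mulNr opprB -subrX1 coef_fpsN coef_fpsD coef_fpsN.
by rewrite coef_exp_eq0 // add0r opprK.
Qed.

Fact fps_unitP f g : g * f = 1 -> fps_unit f.
Proof.
move=> /(congr1 (fun f : fps R => f 0%N)).
rewrite coef_fpsM big_ord1 subnn coef_fps1 => gf1.
by apply/unitrPr; exists (g 0%N); rewrite mulrC.
Qed.

Fact fps_inv_out : {in [predC fps_unit], fps_inv =1 id}.
Proof. by move=> f /negPf nUf; rewrite /fps_inv (nUf : fps_unit f = false). Qed.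

HB.instance Definition _ := GRing.ComNzRing_hasMulInverse.Build (fps R)
  fps_mulV fps_unitP fps_inv_out.

Lemma unit_fpsE f : (f \is a GRing.unit) = (f 0%N \is a GRing.unit).
Proof. by []. Qed.

End UnitRing.

Definition step := bool.
Definition U : step := true.
Definition D : step := false.

Definition height (w : seq step) (i : nat) : int :=
  (count_mem U (take i w))%:Z - (count_mem D (take i w))%:Z.

Definition dyck (n : nat) (w : seq step) : bool :=
  [&& size w == n.*2, height w n.*2 == 0
    & [forall i : 'I_n.*2.+1, 0 <= height w i]].

Definition avoids (alpha w : seq step) : bool := ~~ infix alpha w.

Definition in_F (p n : nat) (w : seq step) : bool :=
  [&& dyck n w, avoids [:: D; U; U] w & avoids (nseq p.+1 D) w].

Record F (p n : nat) := MkF {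
  word :> n.*2.-tuple step;
  wordP : in_F p n word
}.

HB.instance Definition _ p n := [isSub for @word p n].
HB.instance Definition _ p n := [Finite of F p n by <:].

Section Stanley.
Context (p n : nat).
Implicit Types P Q R : F p n.

(* Both paths are linear between consecutive integer abscissas, so comparing
   the ordinates there is enough. *)
Definition stanley_le P Q : bool :=
  [forall i : 'I_n.*2.+1, height P i <= height Q i].

Fact stanley_le_refl : reflexive stanley_le.
Proof. by move=> P; apply/forallP. Qed.

Fact stanley_le_trans : transitive stanley_le.
Proof.
move=> Q P R /forallP lePQ /forallP leQR; apply/forallP => i.
exact: le_trans (lePQ i) (leQR i).
Qed.

Let nth_height (w : seq step) i : (i < size w)%N ->
  nth D w i = (height w i < height w i.+1).
Proof.
move=> lti; rewrite /height (take_nth D lti) -cats1 !count_cat /=.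
by case: (nth D w i) => /=; rewrite ?addn0 ?PoszD; lia.
Qed.

Fact stanley_le_anti : antisymmetric stanley_le.
Proof.
move=> P Q /andP[/forallP lePQ /forallP leQP].
have eqh i : (i <= n.*2)%N -> height P i = height Q i.
  rewrite -ltnS => lti; apply: le_anti.
  by rewrite (lePQ (Ordinal lti)) (leQP (Ordinal lti)).
apply/val_inj/val_inj; apply: (@eq_from_nth _ D); first by rewrite !size_tuple.
move=> i; rewrite size_tuple => lti.
by rewrite !nth_height ?size_tuple // !eqh // ltnW.
Qed.

Fact stanley_display : Order.disp_t. Proof. exact: Order.Disp tt tt. Qed.

HB.instance Definition _ := Order.Le_isPOrder.Build stanley_display (F p n)
  stanley_le_refl stanley_le_anti stanley_le_trans.

End Stanley.

Definition upper_covers d (T : finPOrderType d) (P : T) : {set T} :=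
  [set Q | (P < Q)%O & [forall R : T, ~~ (P < R < Q)%O]].

Definition a (p n k : nat) : nat := #|[set P : F p n | #|upper_covers P| == k]|.

(* A bivariate series is a series in x whose coefficients are series in y. *)
Definition x : fps (fps int) := fps_var (fps int).
Definition y : fps (fps int) := fps_const (fps_var int).

Definition gf (c : nat -> nat -> nat) : fps (fps int) :=
  Fps (fun n => Fps (fun k => (c n k)%:Z)).

(* Main.v *)
Require Import Defs.
From mathcomp Require Import all_boot all_order all_algebra.
From mathcomp Require Import zify ring.
Set Implicit Arguments.
Unset Strict Implicit.
Unset Printing Implicit Defensive.
Import Order.TTheory GRing.Theory Num.Theory.
Local Open Scope ring_scope.

(* A path avoiding DUU has the form U^a D^{d_1} U D^{d_2} ... U D^{d_m} and is
   determined by the composition e = (d_m, ..., d_1) of n, whose parts are at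
   most p since D^{p+1} is avoided; every such composition occurs. In the
   Stanley order P <= Q iff all partial sums of the composition of P are at
   most those of the composition of Q. Raising one partial sum by 1 forces its
   left neighbour to be raised when the part between them is p, and its right
   neighbour when the part between them is 1; hence an upper cover raises
   exactly one partial sum, namely e_1 + ... + e_i with i < m, e_i < p, and
   e_{i+1} > 1 or i + 1 = m. Counting these indices i while the composition is
   built by adding parts in front gives two linear equations for the
   generating functions. *)

(** * Power series *)

Lemma coef_fps_varXM (R : comNzRingType) m (f : fps R) n :
  (fps_var R ^+ m * f) n = if (m <= n)%N then f (n - m)%N else 0.
Proof.
have X0 : fps_var R 0%N = 0 by [].
have X1 : fps_var R 1%N = 1 by [].
elim: m n => [|m IHm] n; first by rewrite expr0 mul1r subn0.
rewrite exprS -mulrA coef_fpsM; case: n => [|n].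
  by rewrite big_ord1 X0 mul0r.
rewrite big_ord_recl X0 mul0r add0r big_ord_recl X1 mul1r.
rewrite big1 ?addr0 => [|i _]; first by rewrite IHm /bump /= !subSS subn0.
have -> : fps_var R (lift ord0 (lift ord0 i)) = 0 by [].
by rewrite mul0r.
Qed.

Lemma coef_fps_varX (R : comNzRingType) m n :
  (fps_var R ^+ m) n = (n == m)%:R.
Proof.
rewrite -[_ ^+ _]mulr1 coef_fps_varXM coef_fps1.
by rewrite subn_eq0 [n == m]eqn_leq andbC; case: (m <= n)%N.
Qed.

Lemma coef_fps_constM (R : comNzRingType) (c : R) (f : fps R) n :
  (fps_const c * f) n = c * f n.
Proof.
rewrite coef_fpsM big_ord_recl /= subn0 big1 ?addr0 // => i _.
by rewrite mul0r.
Qed.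

(** * Compositions and their generating function *)

Definition composition (p n : nat) (e : seq nat) : bool :=
  all (fun i => 0 < i <= p)%N e && (sumn e == n).

(* [f] is fuel; the list is complete as soon as [n <= f]. *)
Fixpoint compositions_rec (p f n : nat) : seq (seq nat) :=
  if n == 0%N then [:: [::]] else
  if f is f'.+1 then
    [seq i :: e | i <- [seq i <- iota 1 p | i <= n]%N,
                  e <- compositions_rec p f' (n - i)]
  else [::].

Definition compositions p n := compositions_rec p n n.

Lemma compositions_rec_fuel p f n :
  (n <= f)%N -> compositions_rec p f n = compositions p n.
Proof.
rewrite /compositions.
have [m] := ubnP f; elim: m => // m IHm in f n *; case: f => [|f].
  by case: n.
case: n => // n ltfm lenf /=; congr flatten.
apply/eq_in_map => i; rewrite mem_filter mem_iota => /andP[_ /andP[i0 _]].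
congr map; rewrite IHm ?IHm //; lia.
Qed.

Lemma compositionsS p n :
  compositions p n.+1 =
  [seq i :: e | i <- [seq i <- iota 1 p | i <= n.+1]%N,
                e <- compositions p (n.+1 - i)].
Proof.
rewrite {1}/compositions /=; congr flatten.
apply/eq_in_map => i; rewrite mem_filter mem_iota => /andP[_ /andP[i0 _]].
by rewrite compositions_rec_fuel //; lia.
Qed.

Lemma mem_compositions p n e : (e \in compositions p n) = composition p n e.
Proof.
have [m] := ubnP n; elim: m => // m IHm in n e *.
case: n => [|n] ltnm.
  rewrite /compositions /= inE /composition; case: e => [|i e] //=.
  by case: i => //= i; rewrite andbF.
rewrite compositionsS; apply/allpairsPdep/idP => [[i [f]] []|].
  rewrite mem_filter mem_iota => /and3P[lein i0 ip] + ->.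
  rewrite IHm; last by lia.
  rewrite /composition /= => /andP[-> /eqP ->]; lia.
case: e => [|i e]; rewrite /composition //= => /andP[/andP[ip alle] /eqP se].
exists i, e; split=> //; first by rewrite mem_filter mem_iota; lia.
by rewrite IHm /composition ?alle //=; lia.
Qed.

Lemma compositions_uniq p n : uniq (compositions p n).
Proof.
have [m] := ubnP n; elim: m => // m IHm in n *.
case: n => [|n] ltnm //; rewrite compositionsS.
apply: allpairs_uniq_dep => [|i|[i e] [j f] _ _ [-> ->] //].
  exact/filter_uniq/iota_uniq.
by rewrite mem_filter mem_iota => ?; apply: IHm; lia.
Qed.

(** Indices start at 0: [i] stands for the partial sum [psum e i.+1], raised by moving one unit from
    part [i.+1] to part [i]. *)
Definition sink (p : nat) (e : seq nat) (i : nat) : bool :=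
  (nth 0 e i < p)%N && ((i.+2 == size e) || (1 < nth 0 e i.+1)%N).

Definition sinks (p : nat) (e : seq nat) : seq nat :=
  [seq i <- iota 0 (size e).-1 | sink p e i].

(** The old indices shift by one and keep their status; index 0 is the only new one. *)
Lemma size_sinks_cons p i j e :
  size (sinks p [:: i, j & e]) =
  (((i < p) && ((e == [::]) || (1 < j))) + size (sinks p (j :: e)))%N.
Proof.
rewrite /sinks /= (iotaDl 1 0) filter_map /=.
have -> : [seq k <- iota 0 (size e) | preim (addn 1) (sink p [:: i, j & e]) k] =
          [seq k <- iota 0 (size e) | sink p (j :: e) k].
  by apply: eq_filter => k; rewrite /sink /= !add1n eqSS.
have -> : sink p [:: i, j & e] 0 = (i < p)%N && ((e == [::]) || (1 < j)%N).
  by rewrite /sink /= !eqSS; case: e.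
by case: ifP => _ /=; rewrite size_map.
Qed.

(* To be used with [z = t ^ p] and the sums [s1], [s2], [s2'] of [t ^ i] over
   [1 <= i <= p], [2 <= i < p] and [2 <= i <= p]. *)
Lemma solve_open_closed (R : comNzRingType) (t u z s1 s2 s2' G H : R) :
    (1 - t) * s1 = t - t * z -> (1 - t) * s2 = t ^+ 2 - z ->
    (1 - t) * s2' = t ^+ 2 - t * z ->
    G = s1 + (u * s2 + z) * G + s2' * H -> H = t * (u * G + H) ->
  (1 - t) * ((1 + (G + H)) * (1 - 2 * t + t * z
     - (u - 1) * (t ^+ 2 - z + t * z - t ^+ 2 * z))) =
  (1 - t) * ((1 - t) * (1 + (u - 1) * z)).
Proof.
move=> e1 e2 e3 eG eH.
set d := _ - (u - 1) * _.
(* Eliminating [H] and clearing the geometric sums with powers of [1 - t] leaves a linear equation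
   for [G] alone. *)
have eGd : G * d - (1 - t) * (t - t * z) = 0.
  transitivity ((1 - t) ^+ 2 * (G - (s1 + (u * s2 + z) * G + s2' * H))
    + (1 - t) * ((1 - t) * s1 - (t - t * z))
    + u * G * (1 - t) * ((1 - t) * s2 - (t ^+ 2 - z))
    + (1 - t) * H * ((1 - t) * s2' - (t ^+ 2 - t * z))
    + (t ^+ 2 - t * z) * (H - t * (u * G + H))); first by rewrite /d; ring.
  by rewrite e1 e2 e3 -eG -eH !subrr !mulr0 !addr0.
apply/eqP; rewrite -subr_eq0; apply/eqP.
(* The equation for [H] gives [(1 - t) * (G + H) = (1 - t + t * u) * G]. *)
transitivity ((1 - t + t * u) * (G * d - (1 - t) * (t - t * z))
  + d * (H - t * (u * G + H))); first by rewrite /d; ring.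
by rewrite eGd -eH subrr !mulr0 addr0.
Qed.

(** * Linear equations for weighted compositions *)

Section GeneratingFunction.
Context (p : nat) (p_gt1 : (1 < p)%N).

Local Notation Y := (fps_var int).
Implicit Types (phi psi : seq nat -> fps int) (e : seq nat).

Definition composition_gf phi : fps (fps int) :=
  Fps (fun n => \sum_(e <- compositions p n) phi e).

Local Notation T := composition_gf.

(** The empty composition gives the constant; any other one splits off its first part [i], which
    accounts for the factor [x ^+ i]. *)
Lemma composition_gf_cons phi :
  T phi = fps_const (phi [::]) +
          \sum_(1 <= i < p.+1) x ^+ i * T (fun e => phi (i :: e)).
Proof.
apply: fpsP => n; rewrite coef_fpsD coef_fps_sum.
under eq_bigr do rewrite coef_fps_varXM.
case: n => [|n] /=.
  rewrite /compositions /= big_seq1 big_nat big1 ?addr0 // => i.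
  by case: i.
rewrite compositionsS big_allpairs_dep /= big_filter add0r -big_mkcond /=.
by rewrite /index_iota subn1.
Qed.

Lemma eq_composition_gf phi psi : phi =1 psi -> T phi = T psi.
Proof. by move=> eqf; apply: fpsP => n; apply: eq_bigr. Qed.

Lemma composition_gfD phi psi : T (fun e => phi e + psi e) = T phi + T psi.
Proof. by apply: fpsP => n; rewrite /= big_split. Qed.

Lemma composition_gfZ c phi : T (fun e => c * phi e) = fps_const c * T phi.
Proof. by apply: fpsP => n; rewrite coef_fps_constM /= mulr_sumr. Qed.

Definition wt e : fps int := Y ^+ size (sinks p e).

(* Whether a part put in front of [e] is followed by the condition
   [(i.+2 == size e) || 1 < nth 0 e i.+1] of [sink]. *)
Definition open e : bool :=
  if e is i :: e' then (e' == [::]) || (1 < i)%N else false.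

(** Empty, open and closed compositions are weighted separately: the class of the tail decides
    whether a part below [p] put in front creates a sink. *)
Definition wt0 e : fps int := (e == [::])%:R.
Definition wt_open e : fps int := (open e)%:R * wt e.
Definition wt_closed e : fps int := ((e != [::]) && ~~ open e)%:R * wt e.

Let boolrE : (true%:R = 1 :> fps int) * (false%:R = 0 :> fps int).
Proof. by []. Qed.

Lemma wtE e : wt e = wt0 e + (wt_open e + wt_closed e).
Proof.
rewrite /wt0 /wt_open /wt_closed; case: e => [|i e].
  by rewrite -[_ && _]/false -[open [::]]/false eqxx !boolrE !mul0r !addr0.
rewrite -[_ == _]/false.
by case: (open _); rewrite ?andbF ?andbT !boolrE mul1r mul0r !(addr0, add0r).
Qed.

Lemma wt_cons i j e :
  wt [:: i, j & e] =
  (if (i < p)%N && open (j :: e) then Y else 1) * wt (j :: e).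
Proof.
by rewrite /wt size_sinks_cons exprD /open; case: (_ && _).
Qed.

Lemma wt_open1 i : wt_open [:: i] = 1.
Proof. by rewrite /wt_open -[open _]/true boolrE mul1r. Qed.

(** A leading 1 is open only when it is also the last part. *)
Lemma wt_open_cons1 e : wt_open (1%N :: e) = wt0 e.
Proof.
case: e => [|i e]; first by rewrite wt_open1.
by rewrite /wt_open /wt0 -[open _]/false -[_ == _]/false !boolrE mul0r.
Qed.

(** A leading part above 1 is always open, and [p] itself never creates a sink. *)
Lemma wt_open_cons i e : (1 < i)%N ->
  wt_open (i :: e) =
  wt0 e + ((if (i < p)%N then Y else 1) * wt_open e + wt_closed e).
Proof.
case: e => [|j e] i_gt1.
  rewrite wt_open1 /wt_open /wt_closed /wt0 -[open _]/false.
  by rewrite -[_ && _]/false -[_ == _]/true !boolrE; ring.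
rewrite /wt_open /wt_closed /wt0 wt_cons -[_ == _]/false {1}/open i_gt1 orbT.
by case: (open _); case: (i < p)%N; rewrite /= !boolrE; ring.
Qed.

(** Only a leading 1 with a nonempty tail is closed; as [1 < p], it creates a sink before an open
    tail. *)
Lemma wt_closed_cons i e : (0 < i)%N ->
  wt_closed (i :: e) = (i == 1%N)%:R * (Y * wt_open e + wt_closed e).
Proof.
rewrite /wt_open /wt_closed; case: i => [|[|i]] // _; last first.
  by rewrite {1}/open orbT -[_ == _]/false !boolrE !mul0r.
case: e => [|j e].
  by rewrite -[_ && _]/false -[open _]/false -[_ && _]/false !boolrE; ring.
rewrite wt_cons p_gt1 {1}/open -[_ == _]/false -[j :: e == _]/false.
by case: (open _); rewrite /= !boolrE; ring.
Qed.

Lemma composition_gf0 : T wt0 = 1.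
Proof.
rewrite composition_gf_cons big1 ?addr0 // => i _.
by rewrite (_ : T _ = 0) ?mulr0 //; apply: fpsP => n; rewrite /= big1.
Qed.

Lemma geometric_x m n : (m <= n)%N ->
  (1 - x) * \sum_(m <= i < n) x ^+ i = x ^+ m - x ^+ n.
Proof.
move=> lemn; rewrite mulr_sumr (telescope_sumr_eq (fun i => - x ^+ i)) //.
  by rewrite opprK addrC.
by move=> i _; rewrite exprS; ring.
Qed.

(** A leading 1 contributes only the one-part composition, so the sums multiplying the tails start
    at 2; the term of [p] stands apart because it carries no [y]. *)
Lemma composition_gf_open :
  T wt_open = \sum_(1 <= i < p.+1) x ^+ i
    + (y * \sum_(2 <= i < p) x ^+ i + x ^+ p) * T wt_open
    + (\sum_(2 <= i < p.+1) x ^+ i) * T wt_closed.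
Proof.
rewrite {1}composition_gf_cons.
have -> : fps_const (wt_open [::]) = 0.
  by apply: fpsP => n; rewrite /wt_open /= mul0r; case: eqP.
rewrite add0r big_ltn; last by lia.
rewrite (eq_composition_gf wt_open_cons1) composition_gf0 mulr1.
have eqT i : (1 < i)%N -> T (fun e => wt_open (i :: e)) =
    1 + ((if (i < p)%N then y else 1) * T wt_open + T wt_closed).
  move=> i_gt1; rewrite (eq_composition_gf (fun e => wt_open_cons e i_gt1)).
  rewrite !composition_gfD composition_gf0 composition_gfZ.
  by case: (i < p)%N.
have p_gt0 := ltnW p_gt1.
rewrite !(big_nat_recr p) // [T (fun e => wt_open (p :: e))]eqT // ltnn.
rewrite (@eq_big_nat _ _ _ _ _ _
  (fun i => x ^+ i + (y * T wt_open + T wt_closed) * x ^+ i)); last first.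
  by move=> i /andP[i_gt1 ltip]; rewrite eqT // ltip; ring.
rewrite big_split -mulr_sumr /= (big_ltn p_gt1).
ring.
Qed.

Lemma composition_gf_closed :
  T wt_closed = x * (y * T wt_open + T wt_closed).
Proof.
rewrite {1}composition_gf_cons.
have -> : fps_const (wt_closed [::]) = 0.
  by apply: fpsP => n; rewrite /wt_closed /= mul0r; case: eqP.
have eqT i : (0 < i)%N -> T (fun e => wt_closed (i :: e)) =
    fps_const (i == 1%N)%:R * (y * T wt_open + T wt_closed).
  move=> i_gt0; rewrite (eq_composition_gf (fun e => wt_closed_cons e i_gt0)).
  by rewrite composition_gfZ composition_gfD composition_gfZ.
rewrite add0r big_ltn; last by lia.
rewrite eqT // [fps_const _]/(1 : fps (fps int)) mul1r expr1.
rewrite big_nat big1 ?addr0 // => i /andP[i_gt1 _].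
rewrite eqT; last by lia.
rewrite (_ : fps_const _ = 0) ?mul0r ?mulr0 //.
by apply: fpsP => n /=; case: (i =P 1%N) i_gt1 => [->|] //; case: ifP.
Qed.

Lemma composition_gf_wt :
  T wt = ((1 - x) * (1 + (y - 1) * x ^+ p))
    / (1 - 2 * x + x ^+ p.+1
       - (y - 1) * (x ^+ 2 - x ^+ p + x ^+ p.+1 - x ^+ p.+2)).
Proof.
set N := (1 - x) * _; set d := 1 - 2 * x + _ - _.
have unit_const1 (f : fps (fps int)) : f 0%N = 1 -> f \is a GRing.unit.
  by rewrite unit_fpsE => ->; rewrite unitr1.
have x0 (f : fps (fps int)) : (x * f) 0%N = 0.
  by rewrite -[x]expr1 coef_fps_varXM.
have ux : 1 - x \is a GRing.unit.
  by apply: unit_const1; rewrite -[x]mulr1 coef_fpsD coef_fpsN x0 subr0.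
have ud : d \is a GRing.unit.
  (* Since [p] is positive, [x] divides [d - 1]; the exponent [q] makes the quotient explicit. *)
  have [q def_p] : exists q, p = q.+1 by exists p.-1; lia.
  have -> : d = 1 - x * (2 - x ^+ p
      + (y - 1) * (x - x ^+ q + x ^+ p - x ^+ p.+1)).
    by rewrite /d def_p !exprS; ring.
  by apply: unit_const1; rewrite coef_fpsD coef_fpsN x0 subr0.
(* The factor [1 - x], a unit, is brought in to clear the geometric sums. *)
apply: (canRL (mulrK ud)); apply: (mulrI ux).
rewrite (eq_composition_gf wtE) !composition_gfD composition_gf0.
have := geometric_x (leqW (ltnW p_gt1)); have := geometric_x (leqW p_gt1).
have := geometric_x p_gt1; rewrite expr1 [x ^+ p.+1]exprS => e2 e3 e1.
rewrite /d /N [x ^+ p.+1]exprS [x ^+ p.+2](exprD x 2 p).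
exact: solve_open_closed e1 e2 e3 composition_gf_open composition_gf_closed.
Qed.

End GeneratingFunction.

(** * Partial sums and sinks *)

Section PartialSums.
Local Open Scope nat_scope.
Implicit Types (e f : seq nat) (i j p n : nat).

Definition psum e i := sumn (take i e).

Lemma psumS e i : psum e i.+1 = psum e i + nth 0 e i.
Proof.
have [ltie|leei] := ltnP i (size e).
  by rewrite /psum (take_nth 0 ltie) sumn_rcons.
by rewrite /psum !take_oversize ?nth_default ?addn0 // leqW.
Qed.

Lemma psum_oversize e i : size e <= i -> psum e i = sumn e.
Proof. by move=> leei; rewrite /psum take_oversize. Qed.

Lemma psum_leq_sumn e i : psum e i <= sumn e.
Proof. by rewrite -{2}(cat_take_drop i e) sumn_cat leq_addr. Qed.

Lemma leq_psum e : {homo psum e : i j / i <= j}.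
Proof.
apply: homo_leq => [//|k i j|i]; first exact: leq_trans.
by rewrite psumS leq_addr.
Qed.

Lemma psum_lt_sumn e i : psum e i < sumn e -> i < size e.
Proof. by have [//|leei] := ltnP i (size e); rewrite psum_oversize ?ltnn. Qed.

Lemma composition_sumn p n e : composition p n e -> sumn e = n.
Proof. by case/andP => _ /eqP. Qed.

Lemma composition_nth p n e i : composition p n e -> i < size e ->
  0 < nth 0 e i <= p.
Proof. by case/andP => /(all_nthP 0) + _; apply. Qed.

Lemma composition_nth_leq p n e i : composition p n e -> nth 0 e i <= p.
Proof.
move=> ce; have [ltie|leei] := ltnP i (size e); last by rewrite nth_default.
by case/andP: (composition_nth ce ltie).
Qed.

Lemma mem_sinks p e i : (i \in sinks p e) = (i.+1 < size e) && sink p e i.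
Proof. by rewrite mem_filter mem_iota andbC; case: e => [|j e]. Qed.

(* Raises the partial sum [psum e i.+1] by one when [i] is a sink; a last
   part equal to 1 then disappears. *)
Fixpoint raise e i : seq nat :=
  match i, e with
  | 0, [:: a, b & e'] => a.+1 :: (if b == 1 then e' else b.-1 :: e')
  | i'.+1, a :: e' => a :: raise e' i'
  | _, _ => e
  end.

(** A part 1 is dropped only when it is the last part, so no later partial sum is shifted. *)
Lemma psum_raise p n e i j : composition p n e -> i \in sinks p e ->
  psum (raise e i) j = psum e j + (j == i.+1).
Proof.
rewrite mem_sinks.
elim: e n i j => [|a e IHe] n i j //.
rewrite {1}/composition /= => /andP[/andP[_ alle] _].
case: i => [|i].
  case: e {IHe} alle => [|b e] //= /andP[b0 alle].
  rewrite /sink /= => /andP[_].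
  have psum3 c d g k : psum [:: c, d & g] k.+2 = c + (d + psum g k) by [].
  case: eqP => [[] /esym/size0nil -> _ | _ /= b1].
    by case: (b =P 1) => [->|bN1]; case: j => [|[|j]];
      rewrite ?psum3 /psum //=; lia.
  have -> : (b == 1) = false by lia.
  by case: j => [|[|j]]; rewrite ?psum3 /psum //=; lia.
move=> sk.
have IH := IHe (sumn e) i j.-1 _ _.
case: j IH => [|j] IH; first by case: (e).
rewrite /psum /= -/(psum _ _) IH ?addnA //.
by rewrite /composition alle /=.
Qed.

Lemma composition_raise p n e i : composition p n e -> i \in sinks p e ->
  composition p n (raise e i).
Proof.
rewrite mem_sinks.
elim: e n i => [|a e IHe] n i //.
rewrite {1}/composition /= => /andP[/andP[a0p alle] /eqP sn].
case: i => [|i].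
  case: e {IHe} alle sn => [|b e] //= /andP[b0 alle] sn.
  rewrite /sink /composition /= => /andP[ap].
  case: (b =P 1) => [b1 _ | bN1 _] /=; rewrite alle /=; lia.
move=> sk.
have /andP[alle' /eqP se] : composition p (sumn e) (raise e i).
  by apply: IHe => //; rewrite /composition alle /=.
by rewrite /composition /= a0p alle' se sn /=.
Qed.

(** The sink is recovered as the place of the only changed partial sum. *)
Lemma raise_inj p n e : composition p n e ->
  {in sinks p e &, injective (raise e)}.
Proof.
move=> ce i j si sj eqb.
have := psum_raise i.+1 ce si; rewrite eqb (psum_raise i.+1 ce sj) eqxx.
by case: eqP => [[]|] //; lia.
Qed.

(* If the partial sum at [j] has to grow, then so does the one at [j - 1]
   when the part ending at [j] equals [p], and the one at [j + 1] when the
   next part equals 1. Moving left as far as possible, then right, one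
   reaches a sink. *)
Lemma exists_sink_leq p n e f j : 1 < p ->
    composition p n e -> composition p n f ->
    (forall i, psum e i <= psum f i) -> psum e j < psum f j ->
  exists2 i, i \in sinks p e & forall k, psum (raise e i) k <= psum f k.
Proof.
move=> p_gt1 ce cf leef ltj.
pose Q i := (psum e i.+1 < psum f i.+1) && (nth 0 e i < p).
have sizeQ i : psum e i < psum f i -> i < size e.
  move=> lti; apply: psum_lt_sumn; apply: leq_trans lti _.
  by rewrite (composition_sumn ce) -(composition_sumn cf) psum_leq_sumn.
(* At the first partial sum that has to grow, the part of [e] ending there is smaller than that of
   [f], hence below [p]. *)
have exQ : exists i, Q i.
  case: (ex_minnP (ex_intro (fun j => psum e j < psum f j) j ltj)).
  case=> [|i] lti mini; first by rewrite /psum !take0 in lti.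
  exists i; rewrite /Q lti /=.
  have : ~~ (psum e i < psum f i) by apply/negP => /mini; rewrite ltnn.
  have := composition_nth_leq i cf.
  by move: lti; rewrite !psumS; lia.
have ubQ i : Q i -> i <= size e by case/andP => /sizeQ; lia.
case: (ex_maxnP exQ ubQ) => i Qi maxi; have /andP[lti ltp] := Qi.
have si : i \in sinks p e.
  rewrite mem_sinks sizeQ //= /sink ltp /=.
  (* If the next part were a 1 but not the last, [Q i.+1] would hold, against the maximality of
     [i]. *)
  case: eqP => //= iN; rewrite ltnNge; apply/negP => le1.
  have ltse : i.+2 < size e by have := sizeQ _ lti; lia.
  have := composition_nth ce (sizeQ _ lti); have := composition_nth ce ltse.
  move=> n2 n1; have : ~~ Q i.+1 by apply/negP => /maxi; rewrite ltnn.
  rewrite /Q; have := psumS e i.+1; have := psumS f i.+1; have := psumS e i.+2.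
  have := psum_leq_sumn e i.+3; rewrite (composition_sumn ce).
  (* Either a further part of [f] keeps its sum ahead, or [f] has already reached [n], which [e] has
     not reached at [i.+2]. *)
  have [ltf|lef] := ltnP i.+1 (size f).
    by have := composition_nth cf ltf; lia.
  have := composition_sumn cf; have := psum_oversize (leqW lef).
  by have := psum_oversize lef; lia.
exists i => // k; rewrite (psum_raise k ce si).
by case: eqP => [->|_]; rewrite ?addn0 ?addn1.
Qed.

End PartialSums.

(** * Coding of paths by compositions *)

Section Words.
Local Open Scope nat_scope.
Implicit Types (e f l : seq nat) (w r : seq step) (i j k p n : nat).

Local Notation "#U r" := (count_mem U r) (at level 10, r at level 8).
Local Notation "#D r" := (count_mem D r) (at level 10, r at level 8).

Fixpoint blocks l : seq step :=
  if l is a :: l' then nseq a D ++ U :: blocks l' else [::].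

(** [k] counts the down steps since the last up step. Trailing down steps are lost, but a reversed
    Dyck path has none. *)
Fixpoint parse k r : seq nat :=
  match r with
  | [::] => [::]
  | true :: r' => k :: parse 0 r'
  | false :: r' => parse k.+1 r'
  end.

Lemma parse_blocks l : parse 0 (blocks l) = l.
Proof.
elim: l => //= a l IHl.
have parseD k b r : parse k (nseq b D ++ r) = parse (k + b) r.
  by elim: b k => [|b IHb] k; rewrite ?addn0 //= IHb addnS.
by rewrite parseD /= IHl.
Qed.

Lemma blocks_surj r : exists l k, r = blocks l ++ nseq k D.
Proof.
elim: r => [|[] r [l [k ->]]]; first by exists [::], 0.
  by exists (0 :: l), k.
by case: l => [|a l]; [exists [::], k.+1 | exists (a.+1 :: l), k].
Qed.

Lemma countU_blocks l : #U (blocks l) = size l.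
Proof. by elim: l => //= a l IHl; rewrite count_cat count_nseq /= IHl. Qed.

Lemma countD_blocks l : #D (blocks l) = sumn l.
Proof. by elim: l => //= a l IHl; rewrite count_cat count_nseq /= IHl; lia. Qed.

Lemma count_UD r : #U r + #D r = size r.
Proof. by elim: r => //= [[]] r /=; lia. Qed.

Lemma psum_cons a l k : psum (a :: l) k.+1 = a + psum l k.
Proof. by []. Qed.

(** A prefix with [k] up steps contains the first [k] blocks and at most the down steps of the next
    one. *)
Lemma countD_take_blocks l j :
  let k := #U (take j (blocks l)) in
  psum l k <= #D (take j (blocks l)) <= psum l k.+1.
Proof.
elim: l j => [|a l IHl] j //=.
rewrite take_cat size_nseq; case: ltnP => [ltja|leaj].
  by rewrite take_nseq ?(ltnW ltja) // !count_nseq /psum /=; lia.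
rewrite count_cat [#D (_ ++ _)]count_cat !count_nseq.
case: (j - a) => [|j'] /=; first by rewrite /psum /=; lia.
rewrite mul0n mul1n !add0n !add1n !psum_cons.
by rewrite !leq_add2l; apply: IHl.
Qed.

(** The prefix is cut just before the up step that ends block [k]. *)
Lemma take_blocks l k : k < size l -> exists2 j, j <= size (blocks l) &
  #U (take j (blocks l)) = k /\ #D (take j (blocks l)) = psum l k.+1.
Proof.
elim: l k => //= a l IHl [_|k ltk].
  exists a; first by rewrite size_cat size_nseq leq_addr.
  by rewrite take_size_cat ?size_nseq // !count_nseq /psum /= take0 /=; lia.
have [j lej [Uj Dj]] := IHl k ltk.
exists (a + j.+1); first by rewrite size_cat size_nseq /=; lia.
rewrite take_cat size_nseq ltnNge leq_addr /= addKn !count_cat !count_nseq /=.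
by rewrite Uj Dj /psum /=; split; lia.
Qed.

(* The letter ending the [k]-th block is its only up step, so in the word of
   [l] the number of down steps before it is [psum l k]; comparing these
   positions compares the two lattice paths. *)
Lemma blocks_leq l l' : size l = size l' -> sumn l = sumn l' ->
  (forall j, #D (take j (blocks l)) <= #D (take j (blocks l'))) <->
  (forall k, psum l k <= psum l' k).
Proof.
move=> eqs eqsum.
have eqsz : size (blocks l) = size (blocks l').
  by rewrite -!count_UD !countU_blocks !countD_blocks eqs eqsum.
have sum_take j :
    #U (take j (blocks l)) + #D (take j (blocks l)) =
    #U (take j (blocks l')) + #D (take j (blocks l')).
  by rewrite !count_UD !size_take_min eqsz.
split=> [leD [|k]|leS j]; first by rewrite /psum !take0.
  have [ltk|lek] := ltnP k (size l); last first.
    by rewrite !psum_oversize ?eqsum // -?eqs leqW.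
  have [j _ [Uj Dj]] := take_blocks ltk.
  have /andP[_ leDj] := countD_take_blocks l' j.
  rewrite -Dj (leq_trans (leD j)) // (leq_trans leDj) // leq_psum //.
  by have := sum_take j; have := leD j; lia.
(* At equal length, more down steps mean fewer up steps; the bounds of [countD_take_blocks] then
   contradict [leS]. *)
rewrite leqNgt; apply/negP => ltD.
have /andP[_ leDj] := countD_take_blocks l j.
have /andP[leDj' _] := countD_take_blocks l' j.
have ltU : #U (take j (blocks l)) < #U (take j (blocks l')).
  by have := sum_take j; lia.
have := leq_psum l' ltU; have := leS (#U (take j (blocks l))).+1; lia.
Qed.

Definition pad n e := e ++ nseq (n - size e) 0.

Lemma psum_pad n e k : psum (pad n e) k = psum e k.
Proof.
rewrite /psum /pad take_cat; case: ltnP => // lek.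
rewrite sumn_cat [take k e]take_oversize // -[RHS]addn0; congr (_ + _).
have := psum_leq_sumn (nseq (n - size e) 0) (k - size e).
by rewrite sumn_nseq mul0n leqn0 => /eqP.
Qed.

Lemma composition_size p n e : composition p n e -> size e <= n.
Proof.
elim: e n => //= a e IHe n; rewrite {1}/composition /=.
move=> /andP[/andP[a0p alle] /eqP <-].
have : size e <= sumn e by apply: IHe; rewrite /composition alle /=.
lia.
Qed.

Lemma size_pad p n e : composition p n e -> size (pad n e) = n.
Proof. by move=> /composition_size len; rewrite size_cat size_nseq subnKC. Qed.

Lemma sumn_pad p n e : composition p n e -> sumn (pad n e) = n.
Proof.
move=> /composition_sumn sn.
by rewrite sumn_cat sumn_nseq mul0n addn0.
Qed.

(* Read from right to left, the Dyck path coded by the composition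
   [e_1, ..., e_m] of [n] is [D^e_1 U D^e_2 U ... D^e_m U U^(n-m)]. *)
Definition path_word n e := rev (blocks (pad n e)).

Definition code w := [seq i <- parse 0 (rev w) | 0 < i].

Lemma path_wordK p n e : composition p n e -> code (path_word n e) = e.
Proof.
move=> /andP[alle _]; rewrite /code revK parse_blocks filter_cat.
rewrite [X in _ ++ X](eq_in_filter (a2 := pred0)) => [|i]; last first.
  by rewrite mem_nseq => /andP[_ /eqP ->].
rewrite filter_pred0 cats0; apply/all_filterP.
by apply: sub_all alle => i /andP[].
Qed.

(** The path ends at height 0, so its height at [i] is the descent over the remaining steps, which
    form a prefix of [rev w]. *)
Lemma height_rev n w i : #U w = n -> #D w = n -> i <= n.*2 ->
  height w i = ((#D (take (n.*2 - i) (rev w)))%:Z -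
                (#U (take (n.*2 - i) (rev w)))%:Z)%R.
Proof.
move=> Uw Dw lei; have sw : size w = n.*2 by rewrite -count_UD Uw Dw addnn.
rewrite take_rev sw subKn // !count_rev /height.
move: Uw Dw; rewrite -{1 2}(cat_take_drop i w) !count_cat; lia.
Qed.

Lemma dyck_count n w : dyck n w -> #U w = n /\ #D w = n.
Proof.
case/and3P => /eqP sw + _; rewrite /height -sw take_size.
have := count_UD w; lia.
Qed.

(** * Pattern avoidance in terms of blocks *)

Lemma prefix_nseq_blocks k a r :
  prefix (nseq k D) (nseq a D ++ U :: r) = (k <= a).
Proof. by elim: k a => [|k IHk] [|a] //=; rewrite IHk. Qed.

(** A run of down steps lies within a single block. *)
Lemma infix_nseq_blocks p l :
  infix (nseq p.+1 D) (blocks l) = has (fun a => p < a) l.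
Proof.
elim: l => //= a l IHl; rewrite -IHl.
elim: a => [|a IHa]; first by [].
have -> : infix (nseq p.+1 D) (nseq a.+1 D ++ U :: blocks l) =
  prefix (nseq p.+1 D) (nseq a.+1 D ++ U :: blocks l) ||
  infix (nseq p.+1 D) (nseq a D ++ U :: blocks l) by [].
by rewrite IHa prefix_nseq_blocks orbA; congr (_ || _); lia.
Qed.

Definition zeros_last : rel nat := fun a b => (a == 0) ==> (b == 0).

(** [UUD] is [DUU] reversed; it marks an empty block followed by a nonempty one. The [U] in front
    lets the first block be treated like the others. *)
Lemma infix_UUD_blocks l :
  infix [:: U; U; D] (U :: blocks l) = ~~ sorted zeros_last l.
Proof.
have skipD a r : infix [:: U; U; D] (nseq a D ++ r) = infix [:: U; U; D] r.
  by elim: a.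
elim: l => [//|b l IHl]; case: b => [|b].
  have -> : infix [:: U; U; D] (U :: blocks (0 :: l)) =
    prefix [:: D] (blocks l) || infix [:: U; U; D] (U :: blocks l) by [].
  by rewrite IHl; case: l {IHl} => [|[|b] l] //=; rewrite prefix0s.
have -> : infix [:: U; U; D] (U :: blocks (b.+1 :: l)) =
  infix [:: U; U; D] (nseq b D ++ U :: blocks l) by [].
by rewrite skipD IHl; case: l {IHl}.
Qed.

Lemma sorted_zeros_lastP l : sorted zeros_last l ->
  l = [seq i <- l | 0 < i] ++ nseq (size l - size [seq i <- l | 0 < i]) 0.
Proof.
elim: l => //= a l IHl sl.
case: a sl => [|a] sl /=; last by rewrite -IHl //; case: l sl {IHl}.
have -> : l = nseq (size l) 0.
  elim: l sl {IHl} => //= b l IHl /andP[/eqP -> sl].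
  by rewrite -IHl.
have -> : [seq i <- nseq (size l) 0 | 0 < i] = [::] by elim: (size l).
by rewrite size_nseq.
Qed.

Lemma sorted_pad n e : all (leq 1) e -> sorted zeros_last (pad n e).
Proof.
rewrite /pad; elim: e (_ - _) => [|a e IHe] k.
  by case: k => //= k _; elim: k.
by case: a => //= a /(IHe k); case: (e ++ _).
Qed.

Lemma path_word_count p n e : composition p n e ->
  #U (path_word n e) = n /\ #D (path_word n e) = n.
Proof.
move=> ce; rewrite /path_word !count_rev countU_blocks countD_blocks.
by rewrite (size_pad ce) (sumn_pad ce).
Qed.

(** Positivity of the parts is what keeps the coded path above the axis. *)
Lemma leq_psum_composition p n e k : composition p n e -> k <= n ->
  k <= psum e k.
Proof.
move=> ce; elim: k => // k IHk ltkn; have lek := IHk (ltnW ltkn).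
rewrite psumS; have [lts|les] := ltnP k (size e).
  by have := composition_nth ce lts; lia.
by have := psum_oversize les; rewrite (composition_sumn ce); lia.
Qed.

Lemma path_word_in_F p n e : composition p n e -> in_F p n (path_word n e).
Proof.
move=> ce; have [Uw Dw] := path_word_count ce; have /andP[alle _] := ce.
apply/and3P; split.
- apply/and3P; split; first by rewrite -count_UD Uw Dw addnn.
    by rewrite (height_rev Uw Dw) // subnn take0.
  apply/forallP => -[i /=]; rewrite ltnS => lei.
  rewrite (height_rev Uw Dw) // /path_word revK subr_ge0 lez_nat.
  have /andP[] := countD_take_blocks (pad n e) (n.*2 - i).
  set k := #U _; rewrite !psum_pad => leD _; apply: leq_trans leD.
  apply: (leq_psum_composition ce); rewrite -[X in _ <= X](size_pad ce).
  by rewrite -countU_blocks -[X in _ <= #U X](cat_take_drop (n.*2 - i))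
    count_cat leq_addr.
- rewrite /avoids -infix_rev /path_word revK.
  have -> : rev [:: D; U; U] = [:: U; U; D] by [].
  apply/negP => infUUD; have := infix_UUD_blocks (pad n e).
  rewrite infix_consl infUUD orbT => /esym/negP; apply.
  by apply: sorted_pad; apply: sub_all alle => i /andP[].
- rewrite /avoids -infix_rev /path_word revK rev_nseq.
  rewrite infix_nseq_blocks has_cat negb_or has_nseq andbF andbT.
  rewrite -all_predC; apply: sub_all alle => i /andP[_].
  by rewrite /= -leqNgt.
Qed.

Lemma codeP p n w : in_F p n w ->
  composition p n (code w) /\ path_word n (code w) = w.
Proof.
move=> /and3P[dw avUUD avD]; have [Uw Dw] := dyck_count dw.
have sw : size w = n.*2 by rewrite -count_UD Uw Dw addnn.
have h_ge0 i : i <= n.*2 -> (0 <= height w i)%R.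
  rewrite -ltnS => lti; case/and3P: dw => _ _ /forallP h.
  exact: h (Ordinal lti).
have [l [k def_r]] := blocks_surj (rev w).
(* A reversed word ending in [D] would come from a path starting with a down step. *)
case: k def_r => [|k]; last first.
  rewrite -addn1 nseqD catA cats1 => def_r.
  have def_w : w = D :: rev (blocks l ++ nseq k D).
    by rewrite -rev_rcons -def_r revK.
  have := h_ge0 1; rewrite def_w /height /= take0 /= -sw def_w /=.
  by move=> /(_ isT).
rewrite cats0 => def_r.
have Ul : size l = n by rewrite -countU_blocks -def_r count_rev.
have Dl : sumn l = n by rewrite -countD_blocks -def_r count_rev.
have sl : sorted zeros_last l.
  apply/negPn; rewrite -infix_UUD_blocks infix_consl -def_r.
  rewrite -[[:: U; U; D]]/(rev [:: D; U; U]) infix_rev negb_or andbC.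
  rewrite [~~ _]avUUD /= def_r.
  (* The [U] in front creates a new occurrence only if the path ends with an up step, and then its
     height at [n.*2.-1] is -1. *)
  case: l def_r {Ul Dl} => [|[|a] l] //= def_r.
  have n_gt0 : 0 < n by case: (n) sw def_r => // /size0nil ->.
  have := h_ge0 n.*2.-1; rewrite (height_rev Uw Dw); last by lia.
  have -> : n.*2 - n.*2.-1 = 1 by lia.
  by rewrite def_r /= take0 /=; lia.
have def_l := sorted_zeros_lastP sl.
have def_code : code w = [seq i <- l | 0 < i].
  by rewrite /code def_r parse_blocks.
split; last first.
  by rewrite /path_word /pad def_code -{1}Ul -def_l -def_r revK.
apply/andP; split; last first.
  rewrite def_code -[X in _ == X]Dl {2}def_l sumn_cat sumn_nseq mul0n addn0.
  exact: eqxx.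
rewrite def_code all_filter; apply/allP => i il; apply/implyP => /= ->.
move: avD; rewrite /avoids -infix_rev def_r rev_nseq infix_nseq_blocks.
by rewrite -all_predC => /allP/(_ i il); rewrite /= -leqNgt.
Qed.

End Words.
(** * Upper covers *)

Section UpperCovers.
Context (p n : nat).
Implicit Types P Q : F p n.

Local Notation code := (fun P : F p n => code (word P)).

Lemma code_composition P : composition p n (code P).
Proof. by case: (codeP (wordP P)). Qed.

Lemma codeK P : path_word n (code P) = P.
Proof. by case: (codeP (wordP P)). Qed.

Lemma code_inj : injective code.
Proof.
by move=> P Q eqPQ; do 2!apply: val_inj; rewrite /= -codeK eqPQ codeK.
Qed.

Lemma code_surj e : composition p n e -> exists P, code P = e.
Proof.
move=> ce; have wF := path_word_in_F ce.
have sw : size (path_word n e) == n.*2 by case/and3P: wF => /and3P[].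
by exists (MkF (wF : in_F p n (Tuple sw))); apply: path_wordK ce.
Qed.

Lemma perm_code : perm_eq [seq code P | P <- enum {: F p n}] (compositions p n).
Proof.
apply: uniq_perm => [||e]; last rewrite mem_compositions.
- by rewrite (map_inj_uniq code_inj) enum_uniq.
- exact: compositions_uniq.
apply/mapP/idP => [[P _ ->]|/code_surj[P <-]]; first exact: code_composition.
by exists P; rewrite ?mem_enum.
Qed.

(** By [height_rev], heights are read off prefixes of the reversed words; at equal length, the
    higher path has more down steps there, and [blocks_leq] applies. *)
Lemma le_code P Q : reflect (forall k, psum (code P) k <= psum (code Q) k)%N
  (P <= Q)%O.
Proof.
have pad_code R :=
  (size_pad (code_composition R), sumn_pad (code_composition R)).
have eqle := @blocks_leq (pad n (code P)) (pad n (code Q)).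
rewrite !pad_code in eqle; have {}eqle := eqle erefl erefl.
have heightE (R : F p n) i : (i <= n.*2)%N -> height R i =
    (count_mem D (take (n.*2 - i) (blocks (pad n (code R)))))%:Z -
    (count_mem U (take (n.*2 - i) (blocks (pad n (code R)))))%:Z.
  have [UR DR] := path_word_count (code_composition R).
  rewrite !codeK in UR DR => lei; rewrite (height_rev UR DR) //.
  by rewrite -[in LHS]codeK /path_word revK.
have sb (R : F p n) : size (blocks (pad n (code R))) = n.*2.
  by rewrite -count_UD countU_blocks countD_blocks !pad_code addnn.
have UDE (R : F p n) j : (count_mem U (take j (blocks (pad n (code R)))) +
    count_mem D (take j (blocks (pad n (code R)))))%N = minn j n.*2.
  by rewrite count_UD size_take_min sb.
have int_leq (b c b' c' m : nat) : (b + c)%N = m -> (b' + c')%N = m ->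
    (c%:Z - b%:Z <= c'%:Z - b'%:Z) = (c <= c')%N by lia.
apply: (iffP forallP) => [lePQ k|leS [i lti]].
  rewrite -(psum_pad n) -[leqRHS](psum_pad n); move: k; apply/eqle => j.
  have [ltj|lej] := leqP j n.*2; last first.
    by rewrite !take_oversize ?sb ?(ltnW lej) // !countD_blocks !pad_code.
  have lti : (n.*2 - j < n.*2.+1)%N by rewrite ltnS leq_subr.
  have := lePQ (Ordinal lti); rewrite /= !heightE ?leq_subr // subKn //.
  by rewrite (int_leq _ _ _ _ _ (UDE P j) (UDE Q j)).
rewrite /= !heightE // (int_leq _ _ _ _ _ (UDE _ _) (UDE _ _)).
have leD : forall j, (count_mem D (take j (blocks (pad n (code P)))) <=
    count_mem D (take j (blocks (pad n (code Q)))))%N.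
  by apply/eqle => k; rewrite !psum_pad.
exact: leD.
Qed.

(** [raise] maps the sinks bijectively to the codes of the upper covers. *)
Lemma card_upper_covers P : (1 < p)%N ->
  #|upper_covers P| = size (sinks p (code P)).
Proof.
move=> p_gt1; have cP := code_composition P.
rewrite cardE -(size_map code) -(size_map (raise (code P))).
apply: perm_size; apply: uniq_perm => [||e].
- by rewrite (map_inj_uniq code_inj) enum_uniq.
- rewrite map_inj_in_uniq ?filter_uniq ?iota_uniq //.
  exact: raise_inj cP.
have raise_gt Q i : i \in sinks p (code P) -> code Q = raise (code P) i ->
    (P < Q)%O.
  move=> si eQ; rewrite lt_neqAle; apply/andP; split; last first.
    by apply/le_code => k; rewrite eQ (psum_raise k cP si) leq_addr.
  apply/eqP => eqPQ; have := psum_raise i.+1 cP si.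
  by rewrite -eQ eqPQ eqxx; lia.
apply/mapP/mapP => [[Q]|[i si ->]].
  rewrite mem_enum inE => /andP[ltPQ /forallP noR] ->.
  have [j ltj] : exists j, (psum (code P) j < psum (code Q) j)%N.
    have /boolp.existsNP[j /negP ltj] :
        ~ forall j, (psum (code Q) j <= psum (code P) j)%N.
      by move/le_code; rewrite lt_geF.
    by exists j; rewrite ltnNge.
  have leS := elimT (le_code P Q) (ltW ltPQ).
  (* A raised composition lies above [P] and weakly below [Q], so the cover [Q] must be coded by
     it. *)
  have [i si leb] := exists_sink_leq p_gt1 cP (code_composition Q) leS ltj.
  have [R eR] := code_surj (composition_raise cP si).
  exists i => //; rewrite -eR; congr (code _).
  have leRQ : (R <= Q)%O by apply/le_code => k; rewrite eR.
  have := noR R; rewrite (raise_gt R i si eR) /= => /negP ltRQ.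
  apply/eqP; apply/negPn/negP => neQR; apply: ltRQ.
  by rewrite lt_neqAle eq_sym neQR.
have [Q eQ] := code_surj (composition_raise cP si).
exists Q => //; rewrite mem_enum inE (raise_gt Q i si eQ) /=.
apply/forallP => R; apply/negP => /andP[ltPR ltRQ].
have leS := elimT (le_code _ _) (ltW ltPR).
have leSQ := elimT (le_code _ _) (ltW ltRQ).
have psQ k := psum_raise k cP si; rewrite -eQ in psQ.
(* [P] and [Q] differ in one partial sum, by one, so its value for [R] decides which of the two [R]
   would equal. *)
have [leR|ltR] := leqP (psum (code R) i.+1) (psum (code P) i.+1).
  suff: (R <= P)%O by rewrite lt_geF.
  apply/le_code => k.
  by have := leSQ k; rewrite psQ; case: eqP => [->|_]; rewrite ?addn0.
suff: (Q <= R)%O by rewrite lt_geF.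
apply/le_code => k.
by rewrite psQ; case: eqP => [->|_]; rewrite ?addn0 ?addn1.
Qed.

End UpperCovers.

Theorem theorem2p1 (p : nat) (hp : (2 <= p)%N) :
  gf (a p) =
    ((1 - x) * (1 + (y - 1) * x ^+ p))
    / (1 - 2 * x + x ^+ p.+1
       - (y - 1) * (x ^+ 2 - x ^+ p + x ^+ p.+1 - x ^+ p.+2)).
Proof.
rewrite -composition_gf_wt //; apply: fpsP => n; apply: fpsP => k.
(* The sum over compositions is carried to paths by [code]; each summand then becomes the indicator
   of having [k] upper covers. *)
rewrite [RHS]coef_fps_sum -(perm_big _ (perm_code p n)) big_map big_enum.
rewrite (eq_bigr (fun P : F p n => (#|upper_covers P| == k)%:R)) => [|P _].
  rewrite /= /a -sum1_card -natr_sum natz; congr Posz.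
  by rewrite [LHS]big_mkcond; apply: eq_bigr => P _; rewrite inE; case: ifP.
by rewrite /wt coef_fps_varX card_upper_covers // eq_sym.
Qed.
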